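(* Let $S$ be a right LCM monoid with core graph $\Gamma=\Gamma(S)$ and coconnected components $\Gamma_i=(V_i,E_i)$, $i\in I$. Then $S$ admits a generalized scale if and only if the following conditions hold: (i) The family $(|V_i|)_{i\in I}\subset\mathbb{N}^\times\cup\{\infty\}$ freely generates a nontrivial submonoid of $\mathbb{N}^\times$. (ii) The coconnected components $\Gamma_i$ are edge-free. (iii) $S$ is noncore factorable. (iv) $S$ has balanced factorization. If $S$ satisfies (i)--(iv), then the generalized scale $N\colon S\to\mathbb{N}^\times$ is determined by $N_s:=|V_i|$ for $s$ noncore irreducible with $[s]\in V_i$.
   Context: $\mathbb{N}^\times$ denotes the multiplicative monoid of positive integers. A right LCM monoid is a left cancellative monoid $S$ (with unit) in which the intersection $sS\cap tS$ of any two principal right ideals is either empty or again a principal right ideal. For $s,t\in S$ write $s\Cap t$ if $sS\cap tS\neq\emptyset$, and $s\perp t$ otherwise. The core of $S$ is $S_c:=\{a\in S\mid a\Cap s\text{ for all }s\in S\}$. Elements $s,t\in S$ are core equivalent, $s\sim t$, if there are $a,b\in S_c$ with $sa=tb$; this is an equivalence relation, and $[s]$ denotes the class of $s$. A generalized scale on $S$ is a nontrivial homomorphism (not identically $1$) $N\colon S\to\mathbb{N}^\times$, $s\mapsto N_s$, such that: (1) $|N^{-1}(n)/_\sim|=n$ for all $n\in N(S)$; (2) $N_s=N_t$ implies $s\sim t$ or $s\perp t$; (3) for all $s\in S$ and $n\in N(S)$ there exists $t\in N^{-1}(n)$ with $s\Cap t$. An element $s\in S$ is noncore irreducible if $s\notin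 S_c$ and whenever $sa=tr$ for some $a\in S_c$ and $t,r\in S$, then $t\in S_c$ or $r\in S_c$. The set of noncore irreducible elements is denoted $\mathcal{I}(S)$; it is closed under $\sim$. The core graph $\Gamma(S)=(V,E)$ is the undirected simplicial graph with vertex set $V=\mathcal{I}(S)/_\sim$ and an edge between distinct vertices $[s],[t]$ if and only if $s\Cap t$ (this is independent of representatives). Its coconnected components $\Gamma_i=(V_i,E_i)$, $i\in I$, are the full subgraphs on the vertex sets $V_i$ of the connected components of the complementary graph $(V,V\times V\setminus E)$, so $E_i=(V_i\times V_i)\cap E$. Edge-free means $E_i=\emptyset$. For $s\in\mathcal{I}(S)$, $i(s)\in I$ is the index with $[s]\in V_{i(s)}$. $S$ is noncore factorable if every element of $S\setminus S_c$ is core equivalent to a finite product of noncore irreducible elements. $S$ has balanced factorization if for all $s,t\in\mathcal{I}(S)$ with $i(s)\neq i(t)$ there are $s',t'\in\mathcal{I}(S)$ with $sS\cap tS=st'S$, $st'=ts'$, $i(s')=i(s)$ and $i(t')=i(t)$. That the family $(|V_i|)_{i\in I}$ freely generates a nontrivial submonoid of $\mathbb{N}^\times$ means: all $|V_i|$ are finite, the homomorphism from the free abelian monoid on $I$ to $\mathbb{N}^\times$ sending the generator $i$ to $|V_i|$ is injective, and its image is not $\{1\}$. *)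

(* Defs.v *)
From HB Require Import structures.
From mathcomp Require Import all_boot finmap.
From mathcomp Require Import mathcomp_extra boolp classical_sets functions.
From mathcomp Require Import cardinality fsbigop.
From Stdlib Require Import Relation_Operators.

Set Implicit Arguments.
Unset Strict Implicit.
Unset Printing Implicit Defensive.

Local Open Scope classical_set_scope.
Local Open Scope card_scope.
Local Open Scope group_scope.

Definition principal_right_ideal {S : monoidType} (s : S) : set S :=
  [set s * r | r in [set: S]].

Definition left_cancellative (S : monoidType) : Prop :=
  forall s t r : S, s * t = s * r -> t = r.

Definition right_LCM (S : monoidType) : Prop :=
  left_cancellative S /\
  forall s t : S,
    let st := principal_right_ideal s `&` principal_right_ideal t in
    st = set0 \/ exists r : S, st = principal_right_ideal r.

Definition meets {S : monoidType} (s t : S) : Prop :=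
  principal_right_ideal s `&` principal_right_ideal t !=set0.

Definition orthogonal {S : monoidType} (s t : S) : Prop := ~ meets s t.

Definition core {S : monoidType} : set S := [set a | forall s : S, meets a s].

Definition core_equiv {S : monoidType} (s t : S) : Prop :=
  exists a b : S, [/\ core a, core b & s * a = t * b].

(* Quotients by core equivalence are formed as sets of classes in [set S]. *)
Definition core_class {S : monoidType} (s : S) : set S :=
  [set t | core_equiv s t].

(* The multiplicative monoid of positive integers is [nat] together with the
   requirement that values are positive. *)
Definition Npos_morphism {S : monoidType} (N : S -> nat) : Prop :=
  [/\ forall s, (0 < N s)%N, N 1 = 1%N &
      forall s t, N (s * t) = (N s * N t)%N].

Definition generalized_scale {S : monoidType} (N : S -> nat) : Prop :=
  [/\ Npos_morphism N /\ (exists s, N s <> 1%N),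
      forall n, range N n -> core_class @` (N @^-1` [set n]) #= `I_n,
      forall s t, N s = N t -> core_equiv s t \/ orthogonal s t &
      forall s n, range N n -> exists t, N t = n /\ meets s t].

Definition noncore_irreducible {S : monoidType} : set S :=
  [set s | ~ core s /\
     forall a t r : S, core a -> s * a = t * r -> core t \/ core r].

Definition core_vertices {S : monoidType} : set (set S) :=
  core_class @` @noncore_irreducible S.

Definition core_edge {S : monoidType} (X Y : set S) : Prop :=
  [/\ core_vertices X, core_vertices Y, X <> Y &
      exists s t : S, [/\ X s, Y t & meets s t]].

Definition complement_edge {S : monoidType} (X Y : set S) : Prop :=
  [/\ core_vertices X, core_vertices Y & ~ core_edge X Y].

Definition cocomponent {S : monoidType} (X : set S) : set (set S) :=
  [set Y | clos_refl_trans _ (@complement_edge S) X Y].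

(* The index set: a coconnected component is indexed by its own vertex set. *)
Definition cocomponents {S : monoidType} : set (set (set S)) :=
  cocomponent @` @core_vertices S.

(* Stands for the index [i(s)], as components index themselves. *)
Definition cocomponent_of {S : monoidType} (s : S) : set (set S) :=
  cocomponent (core_class s).

Definition edge_free {S : monoidType} (C : set (set S)) : Prop :=
  forall X Y, C X -> C Y -> ~ core_edge X Y.

(* The free abelian monoid on [J]: finitely supported exponent functions
   vanishing outside [J]. *)
Definition free_abelian_monoid {I : Type} (J : set I) : set (I -> nat) :=
  [set e | finite_set [set i | e i <> 0%N] /\ forall i, ~ J i -> e i = 0%N].

Definition evaluate {I : choiceType} (J : set I) (k : I -> nat)
    (e : I -> nat) : nat :=
  \big[muln/1%N]_(i \in J) (expn (k i) (e i)).

(* [#|` fset_set (V i)|] is a junk value when [V i] is infinite, but finiteness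
   is required first. *)
Definition freely_generates {I : choiceType} {T : choiceType}
    (J : set I) (V : I -> set T) : Prop :=
  let k i := #|` fset_set (V i)| in
  [/\ forall i, J i -> finite_set (V i) /\ (0 < k i)%N,
      forall e f, free_abelian_monoid J e -> free_abelian_monoid J f ->
        evaluate J k e = evaluate J k f -> e = f &
      exists2 e, free_abelian_monoid J e & evaluate J k e <> 1%N].

Definition noncore_factorable (S : monoidType) : Prop :=
  forall s : S, ~ core s ->
    exists l : seq S, (forall x, x \in l -> noncore_irreducible x) /\
      core_equiv s (\prod_(x <- l) x).

Definition balanced_factorization (S : monoidType) : Prop :=
  forall s t : S, noncore_irreducible s -> noncore_irreducible t ->
    cocomponent_of s <> cocomponent_of t ->
    exists s' t' : S,
      [/\ noncore_irreducible s' /\ noncore_irreducible t',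
          principal_right_ideal s `&` principal_right_ideal t =
            principal_right_ideal (s * t'),
          s * t' = t * s',
          cocomponent_of s' = cocomponent_of s &
          cocomponent_of t' = cocomponent_of t].

Definition scale_conditions (S : monoidType) : Prop :=
  [/\ freely_generates (@cocomponents S) id,
      forall C : set (set S), cocomponents C -> edge_free C,
      noncore_factorable S &
      balanced_factorization S].

Definition cocomponent_sized {S : monoidType} (N : S -> nat) : Prop :=
  forall (s : S) (C : set (set S)),
    noncore_irreducible s -> cocomponents C -> C (core_class s) ->
    C #= `I_(N s).

(* Main.v *)
(* Let N be a generalized scale.  Its kernel is the core, and counting classes
   shows that an element of scale m n is core equivalent to a product of elements
   of scales m and n, so the noncore irreducible elements are those whose scale is
   irreducible in the monoid N(S).  Counting classes at level p q, for distinct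
   irreducible scales p and q, shows that all elements of scales p and q meet and
   that their least common multiple has scale p q.  Hence the coconnected
   components are the level sets of N at irreducible scales, least common multiples
   are balanced, and irreducible scales are prime in N(S), so N(S) is free.

   Conversely, define the scale of a product of noncore irreducible elements as
   the product of the sizes of their components.  Balanced factorization lets one
   move a prescribed irreducible divisor to the front of a product without changing
   the component sizes of the remaining factors, which makes the scale well
   defined; left multiplication by a core element is an automorphism of the core
   graph, so it fixes the components, their sizes being distinct.  The axioms of a
   generalized scale follow by induction on the number of factors. *)
Require Import Defs.
From HB Require Import structures.
From mathcomp Require Import all_boot finmap.
From mathcomp Require Import mathcomp_extra boolp classical_sets functions.
From mathcomp Require Import cardinality fsbigop.
(* Again, because [classical_sets] exports another [meets]. *)
Import Defs.

Set Implicit Arguments.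
Unset Strict Implicit.
Unset Printing Implicit Defensive.

Local Open Scope classical_set_scope.
Local Open Scope card_scope.
Local Open Scope group_scope.

Local Notation "s ~= t" := (core_equiv s t) (at level 70, no associativity).

(** * Common multiples, the core and core equivalence in a right LCM monoid *)

Section CoreCalculus.

Variable S : monoidType.
Hypothesis LCM : right_LCM S.
Implicit Types (s t r x y a b : S).

Let cancel s t r : s * t = s * r -> t = r := LCM.1 s t r.

Lemma meetsP s t : meets s t <-> exists x y, s * x = t * y.
Proof.
split=> [[_ [[x _ <-] [y _ e]]]|[x [y e]]]; first by exists x, y.
by exists (s * x); split; [exists x | exists y].
Qed.

Lemma meets_refl s : meets s s.
Proof. by apply/meetsP; exists 1, 1. Qed.

Lemma meets_sym s t : meets s t -> meets t s.
Proof. by case/meetsP=> x [y e]; apply/meetsP; exists y, x. Qed.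

Lemma meets_mulr s t x : meets (s * x) t -> meets s t.
Proof.
by case/meetsP=> u [v e]; apply/meetsP; exists (x * u), v; rewrite mulgA.
Qed.

Lemma meets_factors s t x y : meets (s * x) (t * y) -> meets s t.
Proof. by move=> /meets_mulr/meets_sym/meets_mulr/meets_sym. Qed.

Lemma meets_mull r s t : meets (r * s) (r * t) <-> meets s t.
Proof.
split=> /meetsP[x [y e]]; apply/meetsP; exists x, y.
  by apply: (@cancel r); rewrite !mulgA.
by rewrite -!mulgA e.
Qed.

(** Phrased through the cofactors, since these are what later carries scales and component sizes. *)
Definition is_lcm s t s' t' :=
  s * s' = t * t' /\
  forall x y, s * x = t * y -> exists v, x = s' * v /\ y = t' * v.

Lemma is_lcmP s t s' t' : s * s' = t * t' ->
  is_lcm s t s' t' <->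
  principal_right_ideal s `&` principal_right_ideal t =
    principal_right_ideal (s * s').
Proof.
move=> e; split=> [[_ lcmP]|E].
  apply/seteqP; split=> [_ [[x _ <-] [y _ /esym/lcmP[v [-> _]]]]|_ [v _ <-]].
    by exists v; rewrite ?mulgA.
  by split; [exists (s' * v) | exists (t' * v)]; rewrite // mulgA ?e.
split=> // x y exy.
have : (principal_right_ideal s `&` principal_right_ideal t) (s * x).
  by split; [exists x | exists y].
rewrite E => -[v _ ev]; exists v; split.
  by apply: (@cancel s); rewrite -ev mulgA.
by apply: (@cancel t); rewrite -exy -ev e mulgA.
Qed.

Lemma meets_lcm s t : meets s t -> exists s' t', is_lcm s t s' t'.
Proof.
move=> [z zst]; have [e|[r Er]] := LCM.2 s t; first by move: zst; rewrite e.
have [[s' _ es] [t' _ et]] :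
    (principal_right_ideal s `&` principal_right_ideal t) r.
  by rewrite Er; exists 1; rewrite ?mulg1.
by exists s', t'; apply/is_lcmP; rewrite es ?et.
Qed.

Lemma core1 : core (1 : S).
Proof. by move=> s; apply/meetsP; exists s, 1; rewrite mul1g mulg1. Qed.

Lemma coreM a b : core a -> core b -> core (a * b).
Proof.
move=> ca cb s; have /meetsP[x [y e]] := ca s.
have /meetsP[u [v e']] := cb x.
by apply/meetsP; exists u, (y * v); rewrite -mulgA e' mulgA e mulgA.
Qed.

Lemma core_mull a b : core (a * b) -> core a.
Proof. by move=> cab s; apply: meets_mulr (cab s). Qed.

Lemma core_mulr a b : core (a * b) -> core b.
Proof. by move=> cab s; have := cab (a * s) => /meets_mull. Qed.

(** Given [x], the core element [a] meets [t * x]; this common multiple of [a] and [t] factors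
    through the least one, so [t'] meets [x]. *)
Lemma lcm_core a t a' t' : core a -> is_lcm a t a' t' -> core t'.
Proof.
move=> ca [_ lcmP] x; have /meetsP[u [v]] := ca (t * x).
rewrite -mulgA => /lcmP[w [_ e]].
by apply/meetsP; exists w, v.
Qed.

Lemma core_lcm a t : core a -> exists a' t', is_lcm a t a' t' /\ core t'.
Proof.
move=> ca; have [a' [t' lcm]] := meets_lcm (ca t).
by exists a', t'; split=> //; apply: lcm_core lcm.
Qed.

(** Any [t] is divisible by [a] up to a core factor; this replaces inverting core elements. *)
Lemma core_ore a t : core a -> exists a' t', a * a' = t * t' /\ core t'.
Proof. by move=> /(core_lcm t)[a' [t' [[e _] ct']]]; exists a', t'. Qed.

Lemma core_ore2 a b : core a -> core b ->
  exists a' b', [/\ a * a' = b * b', core a' & core b'].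
Proof.
move=> ca cb; have [a' [b' [e cb']]] := core_ore b ca.
by exists a', b'; split=> //; apply: (@core_mulr a); rewrite e; apply: coreM.
Qed.

Lemma ceq_refl s : s ~= s.
Proof. by exists 1, 1; split=> //; apply: core1. Qed.

Lemma ceq_sym s t : s ~= t -> t ~= s.
Proof. by move=> [a [b [ca cb e]]]; exists b, a. Qed.

Lemma ceq_trans t s r : s ~= t -> t ~= r -> s ~= r.
Proof.
move=> [a [b [ca cb e]]] [c [d [cc cd e']]].
have [b' [c' [e'' cb' cc']]] := core_ore2 cb cc.
exists (a * b'), (d * c'); split; [exact: coreM | exact: coreM |].
by rewrite mulgA e -mulgA e'' mulgA e' mulgA.
Qed.

Lemma ceq_mul_core s a : core a -> s * a ~= s.
Proof.
by move=> ca; exists 1, a; split=> //; [exact: core1 | rewrite mulg1].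
Qed.

Lemma ceqMl r s t : r * s ~= r * t <-> s ~= t.
Proof.
split=> -[a [b [ca cb e]]]; exists a, b; split=> //.
  by apply: (@cancel r); rewrite !mulgA.
by rewrite -!mulgA e.
Qed.

(* Core equivalence is not a right congruence: [s * r] is only equivalent to
   [t * r'] for some [r'] differing from [r] by core elements on both sides. *)
Lemma ceq_mulr s t r : s ~= t ->
  exists a b z, [/\ core a, core b, a * z ~= r & s * r ~= t * (b * z)].
Proof.
move=> [a [b [ca cb e]]]; have [a' [r' [e' cr']]] := core_ore r ca.
exists a, b, a'; split=> //; first by rewrite e'; apply: ceq_mul_core.
rewrite mulgA -e -mulgA e' mulgA; apply: ceq_sym; exact: ceq_mul_core.
Qed.

Lemma core_ceq s t : s ~= t -> core s -> core t.
Proof.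
by move=> [a [b [ca cb e]]] cs; apply: (@core_mull t b); rewrite -e; apply: coreM.
Qed.

Lemma core_ceq1 s : core s <-> s ~= 1.
Proof.
split=> [cs|/ceq_sym/core_ceq]; last by apply; exact: core1.
by rewrite -[s]mul1g; apply: ceq_mul_core.
Qed.

Lemma meets_ceql s s' t : s ~= s' -> meets s t -> meets s' t.
Proof.
move=> [a [b [ca cb e]]] /meetsP[x [y e']].
have /meetsP[u [v e'']] := ca x.
by apply/meetsP; exists (b * u), (y * v); rewrite mulgA -e -mulgA e'' !mulgA e'.
Qed.

Lemma meets_ceqr s t t' : t ~= t' -> meets s t -> meets s t'.
Proof. by move=> e /meets_sym/(meets_ceql e)/meets_sym. Qed.

Lemma ceq_meets s t : s ~= t -> meets s t.
Proof. by move=> e; apply: meets_ceqr e (meets_refl s). Qed.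

Lemma core_class_eq s t : core_class s = core_class t <-> s ~= t.
Proof.
split=> [e|e]; first by have : core_class t t := ceq_refl t; rewrite -e.
apply/seteqP; split=> r; [exact: ceq_trans (ceq_sym e)|exact: ceq_trans e].
Qed.

Lemma irr_ceq s t : s ~= t -> noncore_irreducible s -> noncore_irreducible t.
Proof.
move=> e [ncs irr]; split=> [/(core_ceq (ceq_sym e))//|c x y cc exy].
case: e => a [b [ca cb e]].
have [b' [c' [e' cb' cc']]] := core_ore2 cb cc.
case: (irr (a * b') x (y * c')); first exact: coreM.
- by rewrite mulgA e -mulgA e' mulgA exy mulgA.
- by left.
- by move=> /core_mull; right.
Qed.

(** To pass from [s] to [a * s]: a factorization [x * y] of [a * s * c] is a common multiple of [a]
    and [x], so their least common multiple gives a factorization [a1 * v] of [s * c]. As the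
    cofactor [x1] is core, [a1] core forces [x] core and [v] core forces [y] core. *)
Lemma irr_coreM a s : core a ->
  noncore_irreducible (a * s) <-> noncore_irreducible s.
Proof.
move=> ca; split=> -[nc irr]; split.
- by move=> cs; apply: nc; apply: coreM.
- move=> c x y cc e; case: (irr c (a * x) y cc); first by rewrite -!mulgA e.
    by move=> /core_mulr; left.
  by right.
- by move=> /core_mulr.
- move=> c x y cc e; have [a1 [x1 [[e1 lcmP] cx1]]] := core_lcm x ca.
  have [|v [e2 e3]] := lcmP (s * c) y; first by rewrite mulgA.
  case: (irr c a1 v cc e2) => cv; last by right; rewrite e3; apply: coreM.
  by left; apply: (@core_mull x x1); rewrite -e1; apply: coreM.
Qed.

(** * The core graph and its coconnected components, in terms of elements *)

Lemma core_edgeP s t : noncore_irreducible s -> noncore_irreducible t ->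
  core_edge (core_class s) (core_class t) <-> ~ s ~= t /\ meets s t.
Proof.
move=> is_ it; split=> [[_ _ ne [s1 [t1 [es et m]]]]|[ne m]].
  split=> [/core_class_eq//|].
  by apply: meets_ceqr (ceq_sym et) _; apply: meets_ceql (ceq_sym es) _.
split; [by exists s | by exists t | by move=> /core_class_eq |].
by exists s, t; split=> //; apply: ceq_refl.
Qed.

Lemma complement_edgeP s t : noncore_irreducible s -> noncore_irreducible t ->
  complement_edge (core_class s) (core_class t) <-> (meets s t -> s ~= t).
Proof.
move=> is_ it; split=> [[_ _ /core_edgeP ne] m|m].
  by apply: contrapT => nst; apply: ne.
split; [by exists s | by exists t |].
by move=> /core_edgeP[]// nst /m.
Qed.

Lemma complement_edge_sym (X Y : set S) :
  complement_edge X Y -> complement_edge Y X.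
Proof.
move=> [vX vY nXY]; split=> // -[_ _ ne [s [t [Ys Xt m]]]]; apply: nXY.
split=> //; first by move=> e; apply: ne.
by exists t, s; split=> //; apply: meets_sym.
Qed.

Lemma cocomponent_vertex (X Y : set S) :
  core_vertices X -> cocomponent X Y -> core_vertices Y.
Proof.
by move=> vX H; elim: H vX => {X Y} // [X Y [] | X Y Z _ IH1 _ IH2 /IH1].
Qed.

Lemma cocomponent_eq (X Y : set S) :
  cocomponent X Y <-> cocomponent X = cocomponent Y.
Proof.
have sym (X1 Y1 : set S) : cocomponent X1 Y1 -> cocomponent Y1 X1.
  elim=> {X1 Y1} [X1 Y1 e|X1|X1 Y1 Z _ IH1 _ IH2].
  - exact/Relation_Operators.rt_step/complement_edge_sym.
  - exact: Relation_Operators.rt_refl.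
  - exact: Relation_Operators.rt_trans IH2 IH1.
split=> [XY|->]; last exact: Relation_Operators.rt_refl.
apply/seteqP; split=> Z; apply: Relation_Operators.rt_trans => //.
exact: sym.
Qed.

Lemma cocomponent_of_ceq s t : s ~= t -> cocomponent_of s = cocomponent_of t.
Proof. by move=> /core_class_eq; rewrite /cocomponent_of => ->. Qed.

Lemma cocomponentsP (C : set (set S)) :
  cocomponents C <-> exists2 s, noncore_irreducible s & C = cocomponent_of s.
Proof.
split=> [[_ [s is_ <-] <-]|[s is_ ->]]; first by exists s.
by exists (core_class s) => //; exists s.
Qed.

Lemma mem_cocomponent_of s t : cocomponent_of s (core_class t) <->
  cocomponent_of s = cocomponent_of t.
Proof. exact: cocomponent_eq. Qed.

Lemma cocomponentE s (X : set S) : noncore_irreducible s ->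
  cocomponent_of s X ->
  exists t, [/\ noncore_irreducible t, X = core_class t &
                cocomponent_of t = cocomponent_of s].
Proof.
move=> is_ sX; have [|t it e] := cocomponent_vertex _ sX; first by exists s.
by exists t; split=> //; apply/esym/mem_cocomponent_of; rewrite e.
Qed.

End CoreCalculus.

(** * Free generation as unique factorization of finite lists *)

Section FreeGeneration.

Variable I : choiceType.
Implicit Types (J : set I) (k e : I -> nat) (l : seq I).

Lemma evaluate_count J k l : (forall i, i \in l -> J i) ->
  evaluate J k (fun i => count_mem i l) = (\prod_(i <- l) k i)%N.
Proof.
move=> lJ; rewrite /evaluate -(@fsbig_widen _ _ _ _ [set` undup l]).
- rewrite -fsbig_seq ?undup_uniq//; exact: big_undup_iterop_count.
- by move=> i /=; rewrite mem_undup => /lJ.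
- by move=> i [_ /=]; rewrite mem_undup => /negP/count_memPn ->.
Qed.

Lemma free_abelian_monoid_count J e : free_abelian_monoid J e ->
  exists2 l, forall i, i \in l -> J i & e = (fun i => count_mem i l).
Proof.
move=> [fin supp].
exists (flatten [seq nseq (e i) i | i <- fset_set [set i | e i <> 0%N]]).
  move=> i /flatten_mapP[j]; rewrite in_fset_set// inE /= => ej.
  rewrite mem_nseq => /andP[_ /eqP ->].
  by apply: contrapT => /supp.
apply/funext => i; rewrite count_flatten -map_comp.
rewrite sumnE big_map /=; under eq_bigr do rewrite count_nseq /=.
have [i_e|/negP i_ne] := boolP (i \in fset_set [set i | e i <> 0%N]).
  rewrite (bigD1_seq i)//= eqxx mul1n big1 ?addn0// => j /negPf ->.
  by rewrite mul0n.
have -> : e i = 0%N.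
  by apply: contrapT => ei; apply: i_ne; rewrite in_fset_set// inE.
rewrite big_seq big1 // => j j_e; case: eqP => [ji|//].
by case: i_ne; rewrite -ji.
Qed.

(** Finitely supported exponent functions are multiplicities in lists. Under freeness, nontriviality
    only asks for an index: a generator equal to 1 would have the same product as the empty list. *)
Lemma freely_generatesP (T : choiceType) J (V : I -> set T) :
  let k i := #|` fset_set (V i)| in
  freely_generates J V <->
  [/\ forall i, J i -> finite_set (V i) /\ (0 < k i)%N,
      forall l1 l2, (forall i, i \in l1 -> J i) -> (forall i, i \in l2 -> J i) ->
        (\prod_(i <- l1) k i = \prod_(i <- l2) k i)%N -> perm_eq l1 l2 &
      J !=set0].
Proof.
move=> k.
have free l : (forall i, i \in l -> J i) ->
    free_abelian_monoid J (fun i => count_mem i l).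
  move=> lJ; split=> [|i nJi]; last by apply/count_memPn/negP => /lJ.
  apply: (@sub_finite_set _ _ [set` l]); last exact: finite_seq.
  by move=> i /= ei; apply: contrapT => /negP/count_memPn.
split=> -[fin inj [x Jx]].
- move=> nx; split=> //.
    move=> l1 l2 lJ1 lJ2 e; apply/allP => i _ /=; apply/eqP.
    suff /(congr1 (fun f => f i)) :
      (fun i => count_mem i l1) = (fun i => count_mem i l2) by [].
    by apply: inj; rewrite ?evaluate_count//; apply: free.
  apply/set0P/negP => /eqP J0; apply: nx.
  by rewrite /evaluate J0 fsbig_set0.
- split=> //.
    move=> e f /free_abelian_monoid_count[l1 lJ1 ->].
    move=> /free_abelian_monoid_count[l2 lJ2 ->]; rewrite !evaluate_count// => ek.
    by apply/funext => i; have /seq.permP := inj _ _ lJ1 lJ2 ek; apply.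
  exists (fun i => count_mem i [:: x]).
    by apply: free => i; rewrite inE => /eqP->.
  rewrite evaluate_count; last by move=> i; rewrite inE => /eqP->.
  move=> e; have /perm_size//: perm_eq [:: x] [::].
  by apply: inj => // [i|]; [rewrite inE => /eqP->|rewrite e big_nil].
Qed.

End FreeGeneration.

(** * From a generalized scale to conditions (i)-(iv) *)

Section ScaleToConditions.

Variable S : monoidType.
Hypothesis LCM : right_LCM S.
Implicit Types (s t r x y a b : S).

Lemma card_core_classes (P : set S) n :
  core_class @` P #= `I_n <->
  exists f : 'I_n -> S,
    [/\ forall i, P (f i), forall i j, f i ~= f j -> i = j &
        forall s, P s -> exists i, s ~= f i].
Proof.
split=> [|[f [fP fI fS]]].
  rewrite card_eq_sym (card_eql card_II) => /card_set_bijP[g [gP gI gS]].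
  have /choice[f fP] i : exists s, P s /\ core_class s = g i.
    by have [s Ps e] := gP i I; exists s.
  exists f; split=> [i|i j /(core_class_eq LCM)|s Ps].
  - exact: (fP i).1.
  - by rewrite !(fP _).2; apply: gI; rewrite inE.
  - have [|i _ e] := gS (core_class s); first by exists s.
    by exists i; apply/(core_class_eq LCM); rewrite (fP i).2.
have -> : core_class @` P = (core_class \o f) @` [set: 'I_n].
  apply/seteqP; split=> [_ [s /fS[i /(core_class_eq LCM) e] <-]|_ [i _ <-]].
    by exists i.
  by exists (f i).
rewrite card_eq_sym (card_eql card_II) card_eq_sym.
by apply: inj_card_eq => i j _ _ /(core_class_eq LCM)/fI.
Qed.

Variable N : S -> nat.
Hypothesis scaleN : generalized_scale N.

Let NM s t : N (s * t) = (N s * N t)%N.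
Proof. by have [[[_ _ ->]]] := scaleN. Qed.

Let N1 : N 1 = 1%N.
Proof. by have [[[_ -> _]]] := scaleN. Qed.

Let N_gt0 s : (0 < N s)%N.
Proof. by have [[[]]] := scaleN. Qed.

Lemma scale_transversal s : exists f : 'I_(N s) -> S,
  [/\ forall i, N (f i) = N s, forall i j, f i ~= f j -> i = j &
      forall t, N t = N s -> exists i, t ~= f i].
Proof.
have [_ card _ _] := scaleN.
by have /card_core_classes := card (N s) (ex_intro2 _ _ s I erefl).
Qed.

Lemma scale_meets s t : N s = N t -> meets s t -> s ~= t.
Proof. by have [_ _ sep _] := scaleN => /sep[]. Qed.

(** Level 1 is a single class, that of [1]. Conversely a core element meets everything, so its level
    is one class, and the number of classes is its scale. *)
Lemma scale_core s : N s = 1%N <-> core s.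
Proof.
split=> [s1|cs].
  have [f [_ _ fS]] := scale_transversal 1; move: (f) fS; rewrite N1 => g gS.
  have [i si] := gS s s1; have [j ej] := gS 1 N1.
  apply/core_ceq1; apply: (ceq_trans LCM) si _.
  by apply: (ceq_sym); rewrite (ord1 i) -(ord1 j).
have [f [fN fI _]] := scale_transversal s; have := N_gt0 s.
have all_eq (i j : 'I_(N s)) : i = j.
  have fs k : f k ~= s.
    by apply: scale_meets => //; apply: meets_sym; apply: cs.
  by apply: fI; apply: (ceq_trans LCM) (fs i) _; apply: ceq_sym.
case: (N s) f fN fI all_eq => [//|[//|n]] _ _ _ /(_ ord0 ord_max).
by move=> /(congr1 val).
Qed.

Lemma scale_ceq s t : s ~= t -> N s = N t.
Proof.
move=> [a [b [/scale_core Na /scale_core Nb /(congr1 N)]]].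
by rewrite !NM Na Nb !muln1.
Qed.

(* Counting: the products [f i * g j] of two transversals are pairwise
   inequivalent, and there are as many of them as classes at their level. *)
Lemma scale_split u s t : N u = (N s * N t)%N ->
  exists x y, [/\ N x = N s, N y = N t & u ~= x * y].
Proof.
move=> Nu; have [f [fN fI _]] := scale_transversal s.
have [g [gN gI _]] := scale_transversal t.
have [h [hN hI hS]] := scale_transversal u.
have /choice[phi phiP] (ij : 'I_(N s) * 'I_(N t)) :
    exists k, f ij.1 * g ij.2 ~= h k.
  by apply: hS; rewrite NM fN gN.
have phiI : injective phi.
  move=> [i j] [i' j'] e; have := phiP (i', j'); rewrite -e => /ceq_sym.
  move=> /(ceq_trans LCM (phiP (i, j))) /= e'.
  have ii' : i = i'.
    apply/fI/scale_meets; rewrite ?fN//.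
    exact: meets_factors (ceq_meets e').
  by move: e'; rewrite ii' => /(ceqMl LCM)/gI ->.
have [k uk] := hS u erefl.
have /codomP[[i j] ek] : k \in codom phi.
  by apply: inj_card_onto phiI _ _; rewrite card_prod !card_ord Nu.
exists (f i), (g j); split=> //; apply: (ceq_trans LCM) uk _.
by rewrite ek; apply: ceq_sym; apply: (phiP (i, j)).
Qed.

(** A factorization of [N s] lifts to one of [s] by [scale_split]; one of [s] up to the core
    descends because the kernel of [N] is the core. *)
Lemma scale_irr s : noncore_irreducible s <->
  N s <> 1%N /\ forall x y, N s = (N x * N y)%N -> N x = 1%N \/ N y = 1%N.
Proof.
split=> [[ncs irr]|[Ns irr]]; split=> [/scale_core//|x y].
- move=> /scale_split[t [r [Nt Nr [a [b [ca cb e]]]]]]; rewrite -Nt -Nr.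
  have [||/core_mull] := irr a t (r * b) ca; first by rewrite mulgA.
    by move/scale_core; left.
  by move/scale_core; right.
move=> r cx /(congr1 N); rewrite !NM (scale_core x).2// muln1 => /irr[e|e].
  by left; apply/scale_core.
by right; apply/scale_core.
Qed.

Lemma scale_irr_eq s t : N s = N t ->
  noncore_irreducible s -> noncore_irreducible t.
Proof. by move=> e /scale_irr; rewrite e => /scale_irr. Qed.

(** Here [u] is equivalent to [s * s' * v] with [N t = N s' * N v]. If [N s'] were 1, then
    [N s = N t * N t'] would force [N s = N t]; so [N v] is 1 and [v] is core. *)
Lemma scale_irr_lcm u s t x y : noncore_irreducible s -> noncore_irreducible t ->
  N s <> N t -> N u = (N s * N t)%N -> u ~= s * x -> u ~= t * y ->
  meets s t /\ forall s' t', is_lcm s t s' t' -> u ~= s * s'.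
Proof.
move=> /scale_irr[Ns irrs] /scale_irr[Nt irrt] ne Nu us ut.
have e : s * x ~= t * y := ceq_trans LCM (ceq_sym us) ut; split.
  exact: meets_factors (ceq_meets e).
move=> s' t' [es lcmP]; have [a [b [ca cb]]] := e.
rewrite -!mulgA => /lcmP[v [e1 _]].
have us'v : u ~= s * s' * v.
  apply: (ceq_trans LCM) us _; rewrite -mulgA -e1 mulgA; apply: ceq_sym.
  exact: ceq_mul_core.
have : (N s * N t = N s * (N s' * N v))%N.
  by rewrite -Nu (scale_ceq us'v) !NM mulnA.
move=> /eqP; rewrite eqn_pmul2l// => /eqP /irrt[] N1'.
  have := congr1 N es; rewrite !NM N1' muln1 => /[dup] est /irrs[//|t'1].
  by case: ne; rewrite est t'1 muln1.
by apply: (ceq_trans LCM) us'v _; apply: ceq_mul_core; apply/scale_core.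
Qed.

(* Counting again: each class at level [N s * N t] has the form of
   [scale_irr_lcm] for exactly one pair of classes at levels [N s] and [N t], so
   every such pair must occur. *)
Lemma scale_irr_meets s t : noncore_irreducible s -> noncore_irreducible t ->
  N s <> N t ->
  exists s' t', [/\ is_lcm s t s' t', N s' = N t & N t' = N s].
Proof.
move=> irrs irrt ne; have [f [fN fI fS]] := scale_transversal s.
have [g [gN gI gS]] := scale_transversal t.
have [h [hN hI hS]] := scale_transversal (s * t).
have shape r r' (n : nat) (f' : 'I_n -> S) k :
    N (s * t) = (N r * N r')%N -> (forall w, N w = N r -> exists i, w ~= f' i) ->
    exists i x, h k ~= f' i * x.
  move=> Nst f'S; have [|w [z [Nw Nz e]]] := @scale_split (h k) r r'.
    by rewrite hN.
  have [i wi] := f'S w Nw; have [a [b [c [_ _ _ e']]]] := ceq_mulr LCM z wi.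
  by exists i, (b * c); apply: (ceq_trans LCM) e _.
have /choice[phi phiP] k : exists ij : 'I_(N s) * 'I_(N t),
    (exists x, h k ~= f ij.1 * x) /\ (exists y, h k ~= g ij.2 * y).
  have [|i hi] := shape s t _ f k _ fS; first by rewrite NM.
  have [|j hj] := shape t s _ g k _ gS; first by rewrite NM mulnC.
  by exists (i, j).
have fi i : noncore_irreducible (f i) by apply: scale_irr_eq irrs; rewrite fN.
have gj j : noncore_irreducible (g j) by apply: scale_irr_eq irrt; rewrite gN.
(* Indices with the same image both name the class of the least common multiple of one pair. *)
have phiI : injective phi.
  move=> k k' e; have [[x ex] [y ey]] := phiP k.
  have := phiP k'; rewrite -e => -[[x' ex'] [y' ey']].
  have Nfg i j : N (f i) <> N (g j) by rewrite fN gN.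
  have Nh l i j : N (h l) = (N (f i) * N (g j))%N by rewrite hN fN gN NM.
  have [m lcm] := scale_irr_lcm (fi _) (gj _) (@Nfg _ _) (Nh _ _ _) ex ey.
  have [_ lcm'] := scale_irr_lcm (fi _) (gj _) (@Nfg _ _) (Nh _ _ _) ex' ey'.
  have [s' [t' l]] := meets_lcm LCM m.
  apply: hI; apply: (ceq_trans LCM) (lcm _ _ l) _.
  by apply: ceq_sym; apply: lcm' l.
have [i si] := fS s erefl; have [j tj] := gS t erefl.
have /codomP[k ek] : (i, j) \in codom phi.
  by apply: inj_card_onto phiI _ _; rewrite card_prod !card_ord NM.
have [[x ex] [y ey]] := phiP k; rewrite -ek /= in ex ey.
have [_ [b [x' [_ _ _ ex']]]] := ceq_mulr LCM x (ceq_sym si).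
have [_ [c [y' [_ _ _ ey']]]] := ceq_mulr LCM y (ceq_sym tj).
have Nh : N (h k) = (N s * N t)%N by rewrite hN NM.
have [m lcm] := scale_irr_lcm irrs irrt ne Nh
  (ceq_trans LCM ex ex') (ceq_trans LCM ey ey').
have [s' [t' l]] := meets_lcm LCM m; exists s', t'.
have Ns' : N s' = N t.
  apply/eqP; rewrite -(eqn_pmul2l (N_gt0 s)) -Nh -NM; apply/eqP.
  by apply/esym/scale_ceq/(lcm _ _ l).
split=> //; apply/eqP; rewrite -(eqn_pmul2l (N_gt0 t)) -NM -l.1 NM Ns'.
by rewrite mulnC.
Qed.

(** Irreducibles of different scales meet without being equivalent, so no complement edge changes
    the scale; those of equal scale are equivalent or orthogonal, hence joined directly. *)
Lemma scale_cocomponent s : noncore_irreducible s ->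
  cocomponent_of s = core_class @` (N @^-1` [set N s]).
Proof.
move=> irrs; apply/seteqP; split=> [X sX|_ [t /= Nt <-]].
  have step (X1 Y1 : set S) : cocomponent X1 Y1 -> core_vertices X1 ->
      forall s1 t1, X1 = core_class s1 -> Y1 = core_class t1 -> N s1 = N t1.
    elim=> {X1 Y1} [X1 Y1 e|X1|X1 Y1 Z XY IH1 YZ IH2] vX s1 t1.
    - move=> eX eY; have [vX1 vY1 _] := e; case: vX1 vY1 => [s2 is2 es] [t2 it2 et].
      have s12 : s1 ~= s2 by apply/(core_class_eq LCM); rewrite es.
      have t12 : t1 ~= t2 by apply/(core_class_eq LCM); rewrite et.
      rewrite (scale_ceq s12) (scale_ceq t12); apply: contrapT => ne.
      have [s' [t' [[e' _] _ _]]] := scale_irr_meets is2 it2 ne.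
      move: e; rewrite -es -et => /(complement_edgeP LCM is2 it2) m.
      by apply/ne/scale_ceq/m/meetsP; exists s', t'.
    - by move=> -> /(core_class_eq LCM)/scale_ceq.
    - have vY := cocomponent_vertex vX XY; case: (vY) => y iy ey ex ez.
      by rewrite (IH1 vX s1 y)// (IH2 vY y t1).
  have [t [irrt eX _]] := cocomponentE irrs sX; exists t => //=.
  apply/esym/(step _ _ sX) => //; by exists s.
constructor; apply/(complement_edgeP LCM) => //; first exact: scale_irr_eq irrs.
exact/scale_meets.
Qed.

Lemma scale_cocomponent_card s : noncore_irreducible s ->
  cocomponent_of s #= `I_(N s).
Proof.
move=> irrs; rewrite scale_cocomponent//; have [_ card _ _] := scaleN.
by apply: card; exists s.
Qed.

Lemma scale_cocomponent_eq s t :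
  noncore_irreducible s -> noncore_irreducible t ->
  cocomponent_of s = cocomponent_of t <-> N s = N t.
Proof.
move=> irrs irrt; split=> [e|e]; last by rewrite !scale_cocomponent// e.
have := scale_cocomponent_card irrs; rewrite e => /card_fset_set <-.
exact/card_fset_set/scale_cocomponent_card.
Qed.

Lemma scale_sized : cocomponent_sized N.
Proof.
move=> s _ irrs [X _ <-] /(cocomponent_eq) ->.
exact: scale_cocomponent_card.
Qed.

Lemma scale_edge_free (C : set (set S)) : cocomponents C -> edge_free C.
Proof.
move=> /cocomponentsP[s irrs ->] X Y; rewrite scale_cocomponent//.
move=> [t /= Nt <-] [r /= Nr <-] edge; have [[t' it' et'] [r' ir' er'] _ _] := edge.
have tt' : t' ~= t by apply/(core_class_eq LCM).
have rr' : r' ~= r by apply/(core_class_eq LCM).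
move: edge => /(core_edgeP LCM (irr_ceq LCM tt' it') (irr_ceq LCM rr' ir'))[ne].
by move/scale_meets => /(_ (etrans Nt (esym Nr))).
Qed.

Lemma scale_factorable : noncore_factorable S.
Proof.
move=> s; have [n] := ubnP (N s); elim: n s => // n IH s ltn ncs.
have [/scale_irr irrs|red] := pselect (N s <> 1%N /\
    forall x y, N s = (N x * N y)%N -> N x = 1%N \/ N y = 1%N).
  exists [:: s]; split; first by move=> x; rewrite inE => /eqP ->.
  by rewrite big_seq1; apply: ceq_refl.
have [x [y [Ns Nx Ny]]] :
    exists x y, [/\ N s = (N x * N y)%N, N x <> 1%N & N y <> 1%N].
  apply: contrapT => nex; apply: red; split=> [/scale_core//|x y Ns].
  apply: contrapT => /not_orP[Nx Ny]; apply: nex; by exists x, y.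
have gt1 m : (0 < m)%N -> m <> 1%N -> (1 < m)%N by case: m => [|[]].
have ltx : (N x < n)%N.
  by apply: leq_trans (ltn_Pmulr (gt1 _ (N_gt0 y) Ny) (N_gt0 x)) _; rewrite -Ns.
have lty : (N y < n)%N.
  by apply: leq_trans (ltn_Pmull (gt1 _ (N_gt0 x) Nx) (N_gt0 y)) _; rewrite -Ns.
have [t [r [Nt Nr str]]] := scale_split Ns.
have [||l1 [l1irr tl1]] := IH t; first by rewrite Nt.
  by rewrite -(scale_core t) Nt.
(* Replacing [t] by its factorization changes the right factor [r] into [b * z], of the same scale,
   so the induction hypothesis is applied to [b * z]. *)
have [a [b [z [/scale_core ca /scale_core cb azr e]]]] := ceq_mulr LCM r tl1.
have Nbz : N (b * z) = N y.
  by rewrite -Nr -(scale_ceq azr) !NM ca cb.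
have [||l2 [l2irr bzl2]] := IH (b * z); first by rewrite Nbz.
  by rewrite -(scale_core (b * z)) Nbz.
exists (l1 ++ l2); split.
  by move=> w; rewrite mem_cat => /orP[/l1irr|/l2irr].
rewrite big_cat /=; apply: (ceq_trans LCM) str _.
by apply: (ceq_trans LCM) e _; apply/(ceqMl LCM).
Qed.

Lemma scale_balanced : balanced_factorization S.
Proof.
move=> s t irrs irrt ne.
have Nst : N s <> N t by move=> e; apply/ne/scale_cocomponent_eq.
have [t' [s' [lcm Nt' Ns']]] := scale_irr_meets irrs irrt Nst.
have irrs' : noncore_irreducible s' by apply: scale_irr_eq irrs.
have irrt' : noncore_irreducible t' by apply: scale_irr_eq irrt.
exists s', t'; split=> //.
- exact/(is_lcmP LCM lcm.1).
- exact: lcm.1.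
- exact/scale_cocomponent_eq.
- exact/scale_cocomponent_eq.
Qed.

Lemma scale_prod (l : seq S) : N (\prod_(x <- l) x) = (\prod_(x <- l) N x)%N.
Proof. by elim: l => [|x l IH]; rewrite ?big_nil// !big_cons NM IH. Qed.

(** If [N s] differs from [N t], then [s * c] is equivalent to a multiple of some [t'] with
    [N t' = N t], and the least common multiple of [s] and [t'] shows that [N t] divides [N c],
    leaving a shorter product divisible by [N s]. *)
Lemma scale_irr_prime s c (l : seq S) : noncore_irreducible s ->
  (forall x, x \in l -> noncore_irreducible x) ->
  (N s * N c = \prod_(x <- l) N x)%N -> N s \in map N l.
Proof.
move=> irrs; elim: l c => [|t l IH] c lirr.
  rewrite big_nil => /eqP; rewrite muln_eq1 => /andP[/eqP Ns _].
  by have [] := (scale_irr s).1 irrs.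
rewrite inE; have [//|/eqP ne] := eqVneq (N s) (N t) => /=.
rewrite big_cons -scale_prod -NM => /scale_split[t' [x [Nt' Nx e]]].
have irrt : noncore_irreducible t by apply: lirr; rewrite mem_head.
have irrt' : noncore_irreducible t' by apply: scale_irr_eq irrt.
have [s' [t'' [[_ lcmP] Ns' _]]] : exists s' t'',
    [/\ is_lcm s t' s' t'', N s' = N t' & N t'' = N s].
  by apply: scale_irr_meets => //; rewrite Nt'.
have [a [b [ca cb]]] := e; rewrite -!mulgA => /lcmP[v [e1 _]].
have Nc : N c = (N t * N v)%N.
  by rewrite -Nt' -Ns' -NM -e1 NM (scale_core a).2 ?muln1.
apply: (IH v); first by move=> y yl; apply: lirr; rewrite inE yl orbT.
have /eqP := scale_ceq e; rewrite !NM Nc Nt' Nx scale_prod mulnCA.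
by rewrite eqn_pmul2l// => /eqP.
Qed.

Lemma scale_irr_unique (l1 l2 : seq S) :
  (forall x, x \in l1 -> noncore_irreducible x) ->
  (forall x, x \in l2 -> noncore_irreducible x) ->
  (\prod_(x <- l1) N x = \prod_(x <- l2) N x)%N -> perm_eq (map N l1) (map N l2).
Proof.
elim: l1 l2 => [|s l1 IH] l2 irr1 irr2.
  rewrite big_nil; case: l2 irr2 => [//|t l2] irr2.
  rewrite big_cons => /esym/eqP; rewrite muln_eq1 => /andP[/eqP Nt _].
  by have [] := (scale_irr t).1 (irr2 t (mem_head _ _)).
rewrite big_cons => e.
have irrs : noncore_irreducible s by apply: irr1; rewrite mem_head.
have : N s \in map N l2.
  by apply: (@scale_irr_prime s (\prod_(x <- l1) x)) => //; rewrite scale_prod.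
move=> /mapP[t tl2 Nst]; have pl2 := perm_to_rem tl2.
rewrite (perm_sym _ (map N l2)) (permPl (perm_map N pl2)) /= -Nst perm_cons.
rewrite perm_sym; apply: IH => [x xl1|x /mem_rem/irr2//|].
  by apply: irr1; rewrite inE xl1 orbT.
apply/eqP; rewrite -(eqn_pmul2l (N_gt0 s)) e (perm_big _ pl2) big_cons Nst.
by [].
Qed.

Lemma scale_freely_generates : freely_generates (@cocomponents S) id.
Proof.
have kE s : noncore_irreducible s -> #|` fset_set (cocomponent_of s)| = N s.
  by move=> irrs; apply/card_fset_set/scale_cocomponent_card.
have lift (l : seq (set (set S))) : (forall C, C \in l -> cocomponents C) ->
    exists2 ls : seq S, forall x, x \in ls -> noncore_irreducible x &
                        l = map cocomponent_of ls.
  elim: l => [_|C l IH lC]; first by exists [::].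
  have [|ls irr ->] := IH; first by move=> D Dl; apply: lC; rewrite inE Dl orbT.
  have [s irrs ->] := (cocomponentsP C).1 (lC _ (mem_head _ _)).
  by exists (s :: ls) => // x; rewrite inE => /orP[/eqP ->|/irr].
have prodE (ls : seq S) : (forall x, x \in ls -> noncore_irreducible x) ->
    (\prod_(C <- map cocomponent_of ls) #|` fset_set C| = \prod_(x <- ls) N x)%N.
  by move=> irr; rewrite big_map; apply: eq_big_seq => x /irr/kE.
apply/freely_generatesP; split.
- move=> _ /cocomponentsP[s irrs ->]; rewrite kE//; split=> //.
  by exists (N s); apply: scale_cocomponent_card.
- move=> _ _ /lift[l1 irr1 ->] /lift[l2 irr2 ->]; rewrite !prodE// => e.
  (* A component is the image of a level set, so a permutation of scales induces one of
     components. *)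
  have := perm_map (fun n => core_class @` (N @^-1` [set n]))
    (scale_irr_unique irr1 irr2 e).
  rewrite -!map_comp; congr (perm_eq _ _).
    by apply/eq_in_map => x /irr1/scale_cocomponent.
  by apply/eq_in_map => x /irr2/scale_cocomponent.
have [[_ [s Ns]] _ _ _] := scaleN.
have [|l [irr sl]] := scale_factorable (s := s); first by move/scale_core.
case: l irr sl => [_|x l irr _].
  by rewrite big_nil => /core_ceq1/scale_core.
by exists (cocomponent_of x); apply/cocomponentsP; exists x => //; apply/irr/mem_head.
Qed.

Lemma scale_conditions_of_scale : scale_conditions S.
Proof.
split; [exact: scale_freely_generates | exact: scale_edge_free |
  exact: scale_factorable | exact: scale_balanced].
Qed.

End ScaleToConditions.

(** * From conditions (i)-(iv): component sizes and the action of the core *)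

Section ConditionsToScale.

Variable S : monoidType.
Hypothesis LCM : right_LCM S.
Hypothesis cond : scale_conditions S.
Implicit Types (s t r x y z a b u : S) (l : seq S).

(** [K l] is the scale that the product [P l] is going to receive. *)
Let k s := #|` fset_set (cocomponent_of s)|.
Let irreducibles l := forall x, x \in l -> noncore_irreducible x.
Let P l := \prod_(x <- l) x.
Let K l := (\prod_(x <- l) k x)%N.

Let P_cons x l : P (x :: l) = x * P l. Proof. exact: big_cons. Qed.
Let K_cons x l : K (x :: l) = (k x * K l)%N. Proof. exact: big_cons. Qed.
Let P_nil : P [::] = 1. Proof. exact: big_nil. Qed.
Let K_nil : K [::] = 1%N. Proof. exact: big_nil. Qed.

Let irrsP x l :
  irreducibles (x :: l) <-> noncore_irreducible x /\ irreducibles l.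
Proof.
split=> [irr|[irrx irrl] y]; last by rewrite inE => /orP[/eqP ->|/irrl].
by split=> [|y yl]; apply: irr; rewrite inE ?eqxx// yl orbT.
Qed.

Lemma component_gt0 s : noncore_irreducible s -> (0 < k s)%N.
Proof.
move=> irrs; have [/freely_generatesP[fin _ _] _ _ _] := cond.
by have [] := fin _ ((cocomponentsP _).2 (ex_intro2 _ _ s irrs erefl)).
Qed.

Lemma component_card s : noncore_irreducible s -> cocomponent_of s #= `I_(k s).
Proof.
move=> irrs; have [/freely_generatesP[fin _ _] _ _ _] := cond.
have [[n /[dup] card /card_fset_set e] _] :=
  fin (cocomponent_of s) ((cocomponentsP _).2 (ex_intro2 _ _ s irrs erefl)).
by rewrite /k e.
Qed.

Lemma component_perm l1 l2 : irreducibles l1 -> irreducibles l2 ->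
  K l1 = K l2 -> perm_eq (map k l1) (map k l2).
Proof.
move=> irr1 irr2 e; have [/freely_generatesP[_ uniq _] _ _ _] := cond.
have lC l : irreducibles l ->
    forall C, C \in map cocomponent_of l -> cocomponents C.
  by move=> irrl _ /mapP[x /irrl irrx ->]; apply/cocomponentsP; exists x.
have := uniq _ _ (lC _ irr1) (lC _ irr2); rewrite !big_map => /(_ e).
by move=> /(perm_map (fun C => #|` fset_set C|)); rewrite -!map_comp.
Qed.

(** Freeness applied to one-element lists. *)
Lemma component_eq s t : noncore_irreducible s -> noncore_irreducible t ->
  k s = k t -> cocomponent_of s = cocomponent_of t.
Proof.
move=> irrs irrt e; have [/freely_generatesP[_ uniq _] _ _ _] := cond.
have inC x : noncore_irreducible x ->
    forall C, C \in [:: cocomponent_of x] -> cocomponents C.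
  by move=> irrx C; rewrite inE => /eqP ->; apply/cocomponentsP; exists x.
have := uniq _ _ (inC s irrs) (inC t irrt); rewrite !big_seq1 => /(_ e).
by move=> /perm_mem/(_ (cocomponent_of s)); rewrite !inE eqxx => /esym/eqP.
Qed.

Lemma component_neq1 s : noncore_irreducible s -> k s <> 1%N.
Proof.
move=> irrs ks; have : perm_eq (map k [:: s]) (map k [::]).
  apply: component_perm => //; first by apply/irrsP.
  by rewrite K_cons K_nil ks.
by move/perm_size.
Qed.

Lemma cocomponent_classes s : noncore_irreducible s ->
  cocomponent_of s = core_class @`
    [set t | noncore_irreducible t /\ cocomponent_of t = cocomponent_of s].
Proof.
move=> irrs; apply/seteqP; split=> [X sX|_ [t [irrt e] <-]].
  by have [t [irrt eX e]] := cocomponentE irrs sX; exists t.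
exact/mem_cocomponent_of.
Qed.

Lemma component_transversal s : noncore_irreducible s ->
  exists f : 'I_(k s) -> S,
    [/\ forall i, noncore_irreducible (f i) /\
          cocomponent_of (f i) = cocomponent_of s,
        forall i j, f i ~= f j -> i = j &
        forall t, noncore_irreducible t -> cocomponent_of t = cocomponent_of s ->
          exists i, t ~= f i].
Proof.
move=> irrs; have := component_card irrs; rewrite {1}cocomponent_classes//.
move=> /(card_core_classes LCM)[f [fP fI fS]]; exists f; split=> // t irrt e.
exact: fS.
Qed.

(** Multiplication by [a] preserves and reflects complement edges, so paths are pushed forward at
    once. To pull a path back, each intermediate vertex is first rewritten as the class of a
    multiple of [a]. *)
Lemma cocomponent_of_core a s t : core a ->
  noncore_irreducible s -> noncore_irreducible t ->
  cocomponent_of (a * s) = cocomponent_of (a * t) <->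
  cocomponent_of s = cocomponent_of t.
Proof.
move=> ca irrs irrt.
have edge x y : noncore_irreducible x -> noncore_irreducible y ->
    complement_edge (core_class (a * x)) (core_class (a * y)) <->
    complement_edge (core_class x) (core_class y).
  move=> irrx irry; split=> /complement_edgeP => /(_ LCM) e.
    apply/(complement_edgeP LCM irrx irry) => m; apply/(ceqMl LCM a).
    by apply: e; rewrite ?irr_coreM//; apply/(meets_mull LCM).
  apply/(complement_edgeP LCM); rewrite ?irr_coreM//.
  by move=> /(meets_mull LCM) m; apply/(ceqMl LCM); apply: e.
split=> /cocomponent_eq e; apply/cocomponent_eq.
  have up (X Y : set S) : cocomponent X Y -> forall x y,
      noncore_irreducible x -> noncore_irreducible y ->
      X = core_class (a * x) -> Y = core_class (a * y) ->
      cocomponent (core_class x) (core_class y).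
    elim=> {X Y} [X Y XY|X|X Z Y XZ IH1 ZY IH2] x y irrx irry eX eY.
    - by apply/Relation_Operators.rt_step/edge => //; rewrite -eX -eY.
    - move: eY; rewrite eX => /(core_class_eq LCM)/(ceqMl LCM)/(core_class_eq LCM) ->.
      exact: Relation_Operators.rt_refl.
    - have vX : core_vertices X by rewrite eX; exists (a * x) => //; apply/irr_coreM.
      have [z irrz ez] := cocomponent_vertex vX XZ.
      have [z' [w [eaz cw]]] := core_ore LCM z ca.
      have azz : z ~= a * z' by rewrite eaz; apply/ceq_sym/ceq_mul_core.
      have irrz' : noncore_irreducible z'.
        by apply/(irr_coreM LCM _ ca)/(irr_ceq LCM azz).
      have eZ : Z = core_class (a * z') by rewrite -ez; apply/(core_class_eq LCM).
      exact: Relation_Operators.rt_trans (IH1 _ _ irrx irrz' eX eZ)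
        (IH2 _ _ irrz' irry eZ eY).
  exact: up e _ _ irrs irrt erefl erefl.
have down (X Y : set S) : cocomponent X Y -> forall x y,
    noncore_irreducible x -> noncore_irreducible y ->
    X = core_class x -> Y = core_class y ->
    cocomponent (core_class (a * x)) (core_class (a * y)).
  elim=> {X Y} [X Y XY|X|X Z Y XZ IH1 ZY IH2] x y irrx irry eX eY.
  - by apply/Relation_Operators.rt_step/edge => //; rewrite -eX -eY.
  - have -> : core_class (a * x) = core_class (a * y).
      by apply/(core_class_eq LCM)/(ceqMl LCM)/(core_class_eq LCM); rewrite -eX.
    exact: Relation_Operators.rt_refl.
  - have vX : core_vertices X by rewrite eX; exists x.
    have [z irrz ez] := cocomponent_vertex vX XZ.
    exact: Relation_Operators.rt_trans (IH1 _ _ irrx irrz eX (esym ez))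
      (IH2 _ _ irrz irry (esym ez) eY).
exact: down e _ _ irrs irrt erefl erefl.
Qed.

(* Left multiplication by a core element is an automorphism of the core graph. *)
Lemma component_core a s : core a -> noncore_irreducible s -> k (a * s) = k s.
Proof.
move=> ca irrs; have [f [fP fI fS]] := component_transversal irrs.
apply: card_fset_set.
have irras : noncore_irreducible (a * s) by apply/irr_coreM.
rewrite cocomponent_classes//.
apply/(card_core_classes LCM); exists (fun i => a * f i).
split=> [i|i j|t [irrt et]].
- have [irrf ef] := fP i; split; first exact/irr_coreM.
  exact/cocomponent_of_core.
- by move=> /(ceqMl LCM)/fI.
have [t' [w [eat cw]]] := core_ore LCM t ca.
have tat : t ~= a * t' by rewrite eat; apply/ceq_sym/ceq_mul_core.
have irrt' : noncore_irreducible t'.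
  by apply/(irr_coreM LCM _ ca)/(irr_ceq LCM tat).
have [|i ti] := fS t' irrt'.
  by apply/(cocomponent_of_core ca) => //; rewrite -et; apply/esym/cocomponent_of_ceq.
by exists i; apply: (ceq_trans LCM) tat _; apply/(ceqMl LCM).
Qed.

Lemma component_ceq s t : s ~= t -> k s = k t.
Proof. by move=> /(cocomponent_of_ceq LCM) e; rewrite /k e. Qed.

(** Equal sizes mean one component, in which inequivalent elements that meet would form an edge. *)
Lemma component_meets s t : noncore_irreducible s -> noncore_irreducible t ->
  k s = k t -> meets s t -> s ~= t.
Proof.
move=> irrs irrt /(component_eq irrs irrt) e m.
have [_ free _ _] := cond; apply: contrapT => ne.
have sC : cocomponents (cocomponent_of s) by apply/cocomponentsP; exists s.
apply: (free _ sC (core_class s) (core_class t)); [exact/mem_cocomponent_of..|].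
exact/(core_edgeP LCM).
Qed.

Lemma component_lcm s t : noncore_irreducible s -> noncore_irreducible t ->
  k s <> k t ->
  exists s' t', [/\ noncore_irreducible s', noncore_irreducible t',
    is_lcm s t t' s', k s' = k s & k t' = k t].
Proof.
move=> irrs irrt ne; have [_ _ _ bal] := cond.
have [|s' [t' [[irrs' irrt'] E e es et]]] := bal s t irrs irrt.
  by move=> e; apply: ne; rewrite /k e.
exists s', t'; split=> //; rewrite /k ?es ?et//.
exact/(is_lcmP LCM e).
Qed.

(* [t |-> t'] with [s t' = t s'] the least common multiple of [s] and [t] is
   injective on the classes of a finite component, hence surjective. *)
Lemma component_lcm_surj s t : noncore_irreducible s -> noncore_irreducible t ->
  k s <> k t ->
  exists t0 s' t', [/\ noncore_irreducible t0, k t0 = k t, is_lcm s t0 t' s' &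
    t' ~= t].
Proof.
move=> irrs irrt ne; have [f [fP fI fS]] := component_transversal irrt.
have kf i : k (f i) = k t by rewrite /k (fP i).2.
have /choice[phi phiP] i : exists j, exists s' t',
    is_lcm s (f i) t' s' /\ t' ~= f j.
  have [|s' [t' [_ irrt' lcm _ kt']]] := component_lcm irrs (fP i).1.
    by rewrite kf.
  have [|j tj] := fS t' irrt'; first by apply: component_eq => //; rewrite kt' kf.
  by exists j, s', t'.
have phiI : injective phi.
  move=> i j e; have [s1 [t1 [[e1 _] ti]]] := phiP i.
  have [s2 [t2 [[e2 _] tj]]] := phiP j; rewrite -e in tj.
  (* Equivalent cofactors give equivalent multiples of [f i] and [f j], which therefore meet inside
     one component. *)
  have := ceq_trans LCM ti (ceq_sym tj) => /(ceqMl LCM s).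
  rewrite e1 e2 => /ceq_meets m.
  apply/fI/component_meets; rewrite ?kf//; [exact: (fP i).1|exact: (fP j).1|].
  exact: meets_factors m.
have [i ti] := fS t irrt erefl.
have /codomP[j ej] := injF_onto phiI i.
have [s' [t' [lcm tj]]] := phiP j; exists (f j), s', t'; split=> //.
  exact: (fP j).1.
by apply: (ceq_trans LCM) tj _; rewrite -ej; apply: ceq_sym.
Qed.

(** * Factorizations into noncore irreducibles, up to core equivalence *)

Lemma factors_core_mull a l : core a -> irreducibles l ->
  exists l', [/\ irreducibles l', K l' = K l & a * P l ~= P l'].
Proof.
move=> ca; case: l => [_|h l /irrsP[irrh irrl]].
  by exists [::]; split=> //; rewrite P_nil mulg1; apply/core_ceq1.
(* The first factor absorbs [a] and keeps its component size by [component_core]. *)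
exists (a * h :: l); split.
- by apply/irrsP; split=> //; apply/irr_coreM.
- by rewrite !K_cons component_core.
- by rewrite !P_cons mulgA; apply: ceq_refl.
Qed.

(** The head [h] is replaced by [b'], where [b * b' = h * h'] with [h'] core; it remains to divide
    the tail by [h']. *)
Lemma factors_core_divl b z l : core b -> irreducibles l -> b * z ~= P l ->
  exists l', [/\ irreducibles l', K l' = K l & z ~= P l'].
Proof.
elim: l b z => [|h l IH] b z cb.
  move=> _; rewrite P_nil => /core_ceq1/(core_mulr LCM) cz.
  by exists [::]; split=> //; rewrite P_nil; apply/core_ceq1.
move=> /irrsP[irrh irrl]; rewrite P_cons => bz.
have [b' [h' [e ch']]] := core_ore LCM h cb.
have [h'' [r [e' cr]]] := core_ore LCM (P l) ch'.
have bbh : b * b' ~= h by rewrite e; apply: ceq_mul_core.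
have irrb' : noncore_irreducible b'.
  by apply/(irr_coreM LCM _ cb)/(irr_ceq LCM (ceq_sym bbh)).
have kb' : k b' = k h by rewrite -(component_core cb irrb') (component_ceq bbh).
have zb : z ~= b' * h''.
  apply/(ceqMl LCM b); apply: (ceq_trans LCM) bz _.
  rewrite mulgA e -mulgA e' mulgA; apply: ceq_sym; exact: ceq_mul_core.
have [|l' [irrl' Kl' h''l']] := IH h' h'' ch' irrl.
  by rewrite e'; apply: ceq_mul_core.
exists (b' :: l'); split; first exact/irrsP.
  by rewrite !K_cons kb' Kl'.
by rewrite P_cons; apply: (ceq_trans LCM) zb _; apply/(ceqMl LCM).
Qed.

(** Compensates for the missing right congruence: the altered right factor from [ceq_mulr] keeps the
    same [K]. *)
Lemma factors_core_exchange a b z x l : core a -> core b -> irreducibles l ->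
  a * z ~= x -> x ~= P l ->
  exists l', [/\ irreducibles l', K l' = K l & b * z ~= P l'].
Proof.
move=> ca cb irrl azx xl.
have [l1 [irr1 <- zl1]] := factors_core_divl ca irrl (ceq_trans LCM azx xl).
have [l2 [irr2 <- bl2]] := factors_core_mull cb irr1.
exists l2; split=> //; apply: (ceq_trans LCM) _ bl2; exact/(ceqMl LCM).
Qed.

(** The head [t] meets [s]. With equal sizes they are equivalent, and [y] is the tail up to core
    elements. Otherwise their least common multiple hands the divisor on to the tail as [s'], and
    [t'] becomes the first factor of [y]. *)
Lemma factors_divl s y l : noncore_irreducible s -> irreducibles l ->
  P l ~= s * y ->
  exists l', [/\ irreducibles l', K l = (k s * K l')%N & y ~= P l'].
Proof.
elim: l s y => [|t l IH] s y irrs.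
  move=> _; rewrite P_nil => /ceq_sym/core_ceq1/core_mull.
  by case: irrs.
move=> /irrsP[irrt irrl]; rewrite P_cons => e.
have mts : meets t s.
  exact: meets_factors (ceq_meets e).
have [kst|kst] := eqVneq (k t) (k s).
  have ts := component_meets irrt irrs kst mts.
  have [a [b [z [ca cb az tsz]]]] := ceq_mulr LCM (P l) ts.
  have [l' [irrl' Kl' bzl']] := factors_core_exchange ca cb irrl az (ceq_refl _).
  exists l'; rewrite K_cons kst Kl'; split=> //.
  apply: (ceq_trans LCM) _ bzl'; apply/(ceqMl LCM s).
  exact: (ceq_trans LCM) (ceq_sym e) tsz.
have [t' [s' [irrt' irrs' [_ lcmP] kt' ks']]] :=
  component_lcm irrt irrs (elimN eqP kst).
have [a [b [ca cb]]] := e; rewrite -!mulgA => /lcmP[v [e1 e2]].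
have [|l' [irrl' Kl' vl']] := IH s' v irrs' irrl.
  apply: (ceq_trans LCM) (ceq_sym (ceq_mul_core _ ca)) _.
  by rewrite e1; apply: ceq_refl.
exists (t' :: l'); split; first exact/irrsP.
  by rewrite !K_cons Kl' ks' kt' mulnCA.
rewrite P_cons; apply: (ceq_trans LCM) (ceq_sym (ceq_mul_core y cb)) _.
by rewrite e2; apply/(ceqMl LCM).
Qed.

Lemma factors_unique l1 l2 : irreducibles l1 -> irreducibles l2 ->
  P l1 ~= P l2 -> K l1 = K l2.
Proof.
elim: l2 l1 => [|s l2 IH] l1 irr1.
  case: l1 irr1 => [//|t l1 /irrsP[[nct _] _] _].
  by rewrite P_nil P_cons => /core_ceq1/core_mull.
move=> /irrsP[irrs irr2]; rewrite P_cons => /(factors_divl irrs irr1).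
move=> [l [irrl -> /ceq_sym e]]; rewrite K_cons.
by rewrite (IH l irrl irr2 e).
Qed.

Lemma factors_exist s : exists l, irreducibles l /\ s ~= P l.
Proof.
have [cs|] := pselect (core s); last by have [_ _ fact _] := cond; apply: fact.
by exists [::]; split=> //; rewrite P_nil; apply/core_ceq1.
Qed.

Lemma factors_scale_exists :
  exists N : S -> nat, forall s l, irreducibles l -> s ~= P l -> N s = K l.
Proof.
have /choice[F FP] := factors_exist; exists (K \o F) => s l irrl sl /=.
have [irrF sF] := FP s; apply: factors_unique => //.
exact: (ceq_trans LCM) (ceq_sym sF) sl.
Qed.

(** Least common multiples carry [s] past heads of other sizes, and the result still meets the tail.
    As its size occurs, a head of that size is reached, where meeting forces equivalence. *)
Lemma factors_peel s l : noncore_irreducible s -> irreducibles l ->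
  k s \in map k l -> meets s (P l) -> exists y, P l ~= s * y.
Proof.
elim: l s => [//|h l IH] s irrs /irrsP[irrh irrl].
rewrite inE P_cons => ksl msl; have mhs : meets h s.
  by apply: meets_mulr; apply: meets_sym msl.
have [khs|khs] := eqVneq (k h) (k s).
  have hs := component_meets irrh irrs khs mhs.
  have [a [b [z [_ _ _ e]]]] := ceq_mulr LCM (P l) hs.
  by exists (b * z).
have {}ksl : k s \in map k l by case/orP: ksl => // /eqP e; rewrite e eqxx in khs.
have [h' [s' [irrh' irrs' [e lcmP] kh' ks']]] :=
  component_lcm irrh irrs (elimN eqP khs).
have [u [v]] := (meetsP _ _).1 msl; rewrite -mulgA => /esym/lcmP[w [ew _]].
have [||y ly] := IH s' irrs' irrl; first by rewrite ks'.
  by apply/meetsP; exists w, v.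
exists (h' * y); rewrite mulgA -e -mulgA; exact/(ceqMl LCM).
Qed.

(** The third scale axiom at irreducible levels, by induction on the factors of [u]: a head of the
    right size serves itself; otherwise [component_lcm_surj] lifts a solution for the tail across
    the head. *)
Lemma component_foundation s u : noncore_irreducible s ->
  exists t, [/\ noncore_irreducible t, k t = k s & meets t u].
Proof.
move=> irrs; have [l [irrl ul]] := factors_exist u.
suff [t [irrt kt m]] : exists t,
    [/\ noncore_irreducible t, k t = k s & meets t (P l)].
  by exists t; split=> //; apply: meets_ceqr (ceq_sym ul) m.
elim: l irrl {ul} => [_|h l IH /irrsP[irrh irrl]].
  by exists s; split=> //; rewrite P_nil; apply: meets_sym; apply: core1.
rewrite P_cons; have [khs|khs] := eqVneq (k h) (k s).
  by exists h; split=> //; apply/meetsP; exists (P l), 1; rewrite mulg1.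
have [t [irrt kt m]] := IH irrl.
have [|t0 [h' [t' [irrt0 kt0 [e _] t't]]]] := component_lcm_surj irrh irrt.
  by rewrite kt; apply/eqP.
exists t0; split; rewrite ?kt0//; apply: (@meets_mulr _ _ _ h').
by rewrite -e; apply/(meets_mull LCM); apply: meets_ceql (ceq_sym t't) m.
Qed.

(** * The function read off from factorizations is a generalized scale *)

Variable N : S -> nat.
Hypothesis NE : forall s l, irreducibles l -> s ~= P l -> N s = K l.

Lemma component_scale_ceq s t : s ~= t -> N s = N t.
Proof.
move=> e; have [l [irrl tl]] := factors_exist t.
by rewrite (NE irrl tl) (NE irrl (ceq_trans LCM e tl)).
Qed.

Lemma component_scale_irr s : noncore_irreducible s -> N s = k s.
Proof.
move=> irrs; rewrite (@NE s [:: s]) ?K_cons ?K_nil ?muln1 ?P_cons ?P_nil ?mulg1//.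
  exact/irrsP.
exact: ceq_refl.
Qed.

Lemma component_scale1 : N 1 = 1%N.
Proof. by rewrite (@NE 1 [::]) ?P_nil//; apply: ceq_refl. Qed.

Lemma component_scaleM s t : N (s * t) = (N s * N t)%N.
Proof.
have [l1 [irr1 sl1]] := factors_exist s; have [l2 [irr2 tl2]] := factors_exist t.
(* The factors of [s] come first; those of [t] are adapted to the core elements that arise when [s]
   is replaced by their product. *)
have [a [b [z [ca cb azt e]]]] := ceq_mulr LCM t sl1.
have [l [irrl Kl bzl]] := factors_core_exchange ca cb irr2 azt tl2.
rewrite (NE irr1 sl1) (NE irr2 tl2) (@NE _ (l1 ++ l)).
- by rewrite /K big_cat /= -/(K l) Kl.
- by move=> x; rewrite mem_cat => /orP[/irr1|/irrl].
- by apply: (ceq_trans LCM) e _; rewrite /P big_cat /=; apply/(ceqMl LCM).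
Qed.

Lemma component_scale_core a : core a -> N a = 1%N.
Proof. by move=> /core_ceq1/component_scale_ceq ->; exact: component_scale1. Qed.

Lemma component_scale_gt0 s : (0 < N s)%N.
Proof.
have [l [irrl sl]] := factors_exist s; rewrite (NE irrl sl).
by rewrite /K big_seq; apply: prodn_cond_gt0 => x /irrl/component_gt0.
Qed.

Lemma component_scale_core_inv s : N s = 1%N -> core s.
Proof.
have [l [irrl sl]] := factors_exist s; rewrite (NE irrl sl) => Kl.
have : perm_eq (map k l) (map k [::]) by apply: component_perm; rewrite ?K_nil.
by move=> /perm_size; case: l sl {irrl Kl} => // /[!P_nil]/core_ceq1.
Qed.

(** Some [s1] of the size of [s] meets [t]; by freeness this size occurs among the factors of [t],
    so [factors_peel] splits [s1] off. *)
Lemma component_scale_peel s t l : noncore_irreducible s ->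
  irreducibles l -> N t = (k s * K l)%N ->
  exists s1 y, [/\ noncore_irreducible s1, k s1 = k s, t ~= s1 * y & N y = K l].
Proof.
move=> irrs irrl Nt; have [s1 [irrs1 ks1 m]] := component_foundation t irrs.
have [lt [irrlt tlt]] := factors_exist t.
have pl : perm_eq (map k lt) (map k (s :: l)).
  apply: component_perm => //; first exact/irrsP.
  by rewrite K_cons -Nt (NE irrlt tlt).
have [||y e] := factors_peel irrs1 irrlt.
- by rewrite (perm_mem pl) ks1 mem_head.
- exact: meets_ceqr tlt m.
have ty := ceq_trans LCM tlt e; exists s1, y; split=> //; apply/eqP.
rewrite -(eqn_pmul2l (component_gt0 irrs)) -Nt (component_scale_ceq ty).
by rewrite component_scaleM (component_scale_irr irrs1) ks1.
Qed.

(** Peel both elements along [h :: l]: the first factors meet in one component, hence are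
    equivalent, and the remainders, adjusted by core elements, meet at the level of [l]. *)
Lemma component_scale_meets l s t : irreducibles l ->
  N s = K l -> N t = K l -> meets s t -> s ~= t.
Proof.
elim: l s t => [|h l IH] s t.
  rewrite K_nil => _ /component_scale_core_inv cs /component_scale_core_inv ct _.
  by apply: (ceq_trans LCM) (ceq_sym _); exact/core_ceq1.
move=> /irrsP[irrh irrl]; rewrite K_cons.
move=> /(component_scale_peel irrh irrl)[s1 [y [irrs1 ks1 sy Ny]]].
move=> /(component_scale_peel irrh irrl)[t1 [z [irrt1 kt1 tz Nz]]] mst.
have {}mst : meets (s1 * y) (t1 * z).
  by apply: meets_ceql sy _; apply: meets_ceqr tz _.
have st1 : s1 ~= t1.
  apply: component_meets; rewrite ?ks1 ?kt1//.
  exact: meets_factors mst.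
have [a [b [w [ca cb awy steq]]]] := ceq_mulr LCM y st1.
apply: (ceq_trans LCM) sy _; apply: (ceq_trans LCM) _ (ceq_sym tz).
apply: (ceq_trans LCM steq _); apply/(ceqMl LCM); apply: IH => //.
  rewrite component_scaleM (component_scale_core cb) mul1n -Ny.
  by rewrite -(component_scale_ceq awy) component_scaleM
    (component_scale_core ca) mul1n.
by apply/(meets_mull LCM t1); apply: meets_ceql steq mst.
Qed.

(** With [t] at the level of [h] and [t * x = u * y], take recursively [z] meeting [x]; then [t * z]
    meets a multiple of [u]. *)
Lemma component_scale_foundation l u : irreducibles l ->
  exists t, N t = K l /\ meets u t.
Proof.
elim: l u => [|h l IH] u.
  move=> _; exists 1; rewrite K_nil component_scale1; split=> //.
  by apply: meets_sym; apply: core1.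
move=> /irrsP[irrh irrl]; have [t [irrt kt]] := component_foundation u irrh.
move=> /meetsP[x [y e]]; have [z [Nz m]] := IH x irrl.
exists (t * z); split.
  by rewrite component_scaleM (component_scale_irr irrt) kt K_cons Nz.
by apply: (@meets_mulr _ _ _ y); rewrite -e; apply/(meets_mull LCM).
Qed.

(** Products of transversals for [h] and [l] are pairwise inequivalent and exhaust the level by
    [component_scale_peel]. The index type is a general finite one to allow for pairs. *)
Lemma component_scale_transversal l : irreducibles l ->
  exists (T : finType) (f : T -> S),
    [/\ #|T| = K l, forall i, N (f i) = K l, forall i j, f i ~= f j -> i = j &
        forall t, N t = K l -> exists i, t ~= f i].
Proof.
elim: l => [_|h l IH /irrsP[irrh irrl]].
  exists unit, (fun=> 1); split=> [||[] []//|t].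
  - by rewrite card_unit.
  - by rewrite K_nil component_scale1.
  - by rewrite K_nil => /component_scale_core_inv ct; exists tt; apply/core_ceq1.
have [T [f [cT fN fI fS]]] := IH irrl.
have [g [gP gI gS]] := component_transversal irrh.
have kg i : k (g i) = k h by rewrite /k (gP i).2.
exists ('I_(k h) * T)%type, (fun ij => g ij.1 * f ij.2); split.
- by rewrite card_prod card_ord cT K_cons.
- by move=> ij; rewrite component_scaleM (component_scale_irr (gP _).1) kg fN K_cons.
- move=> [i j] [i' j'] /= e.
  have ii' : i = i'.
    apply/gI/component_meets; rewrite ?kg//; [exact: (gP _).1..|].
    exact: meets_factors (ceq_meets e).
  by move: e; rewrite ii' => /(ceqMl LCM)/fI ->.
rewrite K_cons => t /(component_scale_peel irrh irrl)[s1 [y [irrs1 ks1 ty Ny]]].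
have [|i si] := gS s1 irrs1; first exact: component_eq.
have [a [b [w [ca cb awy e]]]] := ceq_mulr LCM y si.
have [|j wj] := fS (b * w).
  rewrite component_scaleM (component_scale_core cb) mul1n -Ny.
  by rewrite -(component_scale_ceq awy) component_scaleM
    (component_scale_core ca) mul1n.
exists (i, j); apply: (ceq_trans LCM) ty _; apply: (ceq_trans LCM) e _.
exact/(ceqMl LCM).
Qed.

Lemma component_irr_exists : exists s, @noncore_irreducible S s.
Proof.
have [/freely_generatesP[_ _ [C /cocomponentsP[s irrs _]]] _ _ _] := cond.
by exists s.
Qed.

Lemma component_scale_generalized : generalized_scale N.
Proof.
split.
- split; first by split; [exact: component_scale_gt0 | exact: component_scale1 |
    exact: component_scaleM].
  have [s irrs] := component_irr_exists; exists s.
  by rewrite component_scale_irr//; apply: component_neq1.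
- move=> _ [s _ <-]; have [l [irrl sl]] := factors_exist s.
  have [T [f [cT fN fI fS]]] := component_scale_transversal irrl.
  rewrite (NE irrl sl) -cT; apply/(card_core_classes LCM).
  exists (f \o enum_val); split=> [i|i j /fI/enum_val_inj//|t /=].
    exact: etrans (fN _) (esym cT).
  move=> Nt; have [i ti] := fS t (etrans Nt cT).
  by exists (enum_rank i); rewrite /= enum_rankK.
- move=> s t; have [l [irrl sl]] := factors_exist s.
  rewrite (NE irrl sl) => /esym Nt; have [m|nm] := pselect (meets s t).
    by left; apply: (component_scale_meets irrl) => //; apply: NE.
  by right.
- move=> s _ [t _ <-]; have [l [irrl tl]] := factors_exist t.
  by rewrite (NE irrl tl); apply: component_scale_foundation.
Qed.

Lemma component_scale_sized : cocomponent_sized N.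
Proof.
move=> s _ irrs [X _ <-] /cocomponent_eq ->.
by rewrite component_scale_irr//; apply: component_card.
Qed.

(* A core element [a] has [M a = 1]: it permutes the vertices of each component,
   so [M (a * s) = M s] for [s] irreducible. *)
Lemma sized_morphism_unique (M : S -> nat) :
  Npos_morphism M -> cocomponent_sized M -> M = N.
Proof.
move=> [Mgt0 M1 MM] sized.
have Mk s : noncore_irreducible s -> M s = k s.
  move=> irrs; apply/esym/card_fset_set/sized => //.
    by apply/cocomponentsP; exists s.
  exact/mem_cocomponent_of.
have Mcore a : core a -> M a = 1%N.
  move=> ca; have [s irrs] := component_irr_exists; apply/eqP.
  rewrite -(eqn_pmul2r (Mgt0 s)) -MM mul1n !Mk ?component_core//.
  exact/irr_coreM.
apply/funext => s; have [l [irrl sl]] := factors_exist s.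
rewrite (NE irrl sl); have [a [b [/Mcore Ma /Mcore Mb /(congr1 M)]]] := sl.
rewrite !MM Ma Mb !muln1 => ->.
elim: l irrl {sl} => [|h l IH /irrsP[irrh irrl]]; first by rewrite P_nil K_nil.
by rewrite P_cons K_cons MM Mk// IH.
Qed.

End ConditionsToScale.

Theorem theorem4p13 (S : monoidType) (S_right_LCM : right_LCM S) :
  ((exists N : S -> nat, generalized_scale N) <-> scale_conditions S) /\
  (scale_conditions S ->
   exists N : S -> nat,
     [/\ generalized_scale N,
         cocomponent_sized N,
         forall M : S -> nat, generalized_scale M -> M = N &
         forall M : S -> nat, Npos_morphism M -> cocomponent_sized M -> M = N]).
Proof.
split; first split.
- by move=> [N scaleN]; apply: scale_conditions_of_scale scaleN.
- move=> cond; have [N NE] := factors_scale_exists S_right_LCM cond.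
  by exists N; apply: component_scale_generalized NE.
move=> cond; have [N NE] := factors_scale_exists S_right_LCM cond.
exists N; split.
- exact: component_scale_generalized NE.
- exact: component_scale_sized NE.
(* Every generalized scale takes component sizes on irreducibles, so it is covered by the uniqueness
   of such morphisms. *)
- move=> M scaleM; apply: (sized_morphism_unique S_right_LCM cond NE).
    by have [[]] := scaleM.
  exact: scale_sized scaleM.
- exact: sized_morphism_unique NE.
Qed.
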